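(* Let $H,K,A,Q,B,P$ be functions on $\mathbb{Z}^2$ satisfying the discrete Demoulin system $$\begin{aligned} H_{12}&=-\frac{K(H-1)(K_2-1)}{K[H(H_1-1)(H_2-1)-(H-1)](K_2-1)-AQH_1K_2(H_2-1)},\\ K_{12}&=-\frac{H(K-1)(H_1-1)}{H[K(K_1-1)(K_2-1)-(K-1)](H_1-1)-AQH_1K_2(K_1-1)}, \end{aligned}\qquad A_2=\frac{H_1}{K}A,\quad Q_1=\frac{K_2}{H}Q,$$ together with $$B=\frac{(H_2-1)(K-1)K_2}{(H-1)(K_2-1)H_2}Q,\qquad P=\frac{(H-1)(K_1-1)H_1}{(H_1-1)(K-1)K_1}A,$$ and let $(\varphi,\psi)$ be a vector-valued solution of the associated linear system with parameter $\lambda$ $$\begin{aligned} \varphi_{11}&=\varphi_1+\frac{1-H_1}{(1-H)H_1}(\varphi_1-\varphi)+\frac{\lambda A}{K-1}(\psi_{12}-\psi_1),\\ \varphi_{22}&=\varphi_2+\frac{1-H_2}{(1-H)H_2}(\varphi_2-\varphi)+\frac{B}{\lambda(K-1)}(\psi_{12}-\psi_2),\\ \varphi_{12}&=-\varphi+H(\varphi_1+\varphi_2),\\ \psi_{11}&=\psi_1+\frac{1-K_1}{(1-K)K_1}(\psi_1-\psi)+\frac{\lambda P}{H-1}(\varphi_{12}-\varphi_1),\\ \psi_{22}&=\psi_2+\frac{1-K_2}{(1-K)K_2}(\psi_2-\psi)+\frac{Q}{\lambda(H-1)}(\varphi_{12}-\varphi_2),\\ \psi_{12}&=-\psi+K(\psi_1+\psi_2).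 \end{aligned}$$ Let $(\varphi^\circ,\psi^\circ)$ be a scalar solution of this linear system corresponding to a parameter $\lambda_\circ$, subject to the admissible constraint (i.e. consistent with the linear system) $$(\varphi^\circ)^2-\frac{H}{H-1}\Delta_1\varphi^\circ\,\Delta_2\varphi^\circ=(\psi^\circ)^2-\frac{K}{K-1}\Delta_1\psi^\circ\,\Delta_2\psi^\circ .$$ Put $$c^0=\frac{\lambda_\circ^2}{\lambda^2-\lambda_\circ^2},\quad c^1=\frac{\lambda_\circ\lambda}{\lambda^2-\lambda_\circ^2},\quad c^2=\frac{\lambda^2}{\lambda^2-\lambda_\circ^2},\quad c^3=\frac{\lambda^2+\lambda_\circ^2}{\lambda^2-\lambda_\circ^2},$$ $$\begin{aligned} S={}&c^3\varphi^\circ\varphi-2c^1\psi^\circ\psi-\frac{H}{H-1}\big(c^2\Delta_1\varphi^\circ\,\Delta_2\varphi+c^0\Delta_2\varphi^\circ\,\Delta_1\varphi\big)+\frac{K}{K-1}c^1\big(\Delta_1\psi^\circ\,\Delta_2\psi+\Delta_2\psi^\circ\,\Delta_1\psi\big),\\ R={}&c^3\psi^\circ\psi-2c^1\varphi^\circ\varphi-\frac{K}{K-1}\big(c^2\Delta_1\psi^\circ\,\Delta_2\psi+c^0\Delta_2\psi^\circ\,\Delta_1\psi\big)+\frac{H}{H-1}c^1\big(\Delta_1\varphi^\circ\,\Delta_2\varphi+\Delta_2\varphi^\circ\,\Delta_1\varphi\big). \end{aligned}$$ Then the discrete Demoulin system, the two relations for $B$ and $P$, and the linear system (with the same parameter $\lambda$)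 are invariant under the substitution $(\varphi,\psi,H,K,A,B,P,Q)\to(\varphi',\psi',H',K',A',B',P',Q')$ given by $$\begin{aligned} \varphi'&=\frac{S}{\varphi^\circ}, & H'&=\frac{\varphi_1^\circ\varphi_2^\circ}{\varphi_{12}^\circ\varphi^\circ}H, & A'&=\frac{\varphi_1^\circ\psi_1^\circ}{\varphi_{11}^\circ\psi^\circ}A, & B'&=\frac{\varphi_2^\circ\psi_2^\circ}{\varphi_{22}^\circ\psi^\circ}B,\\ \psi'&=\frac{R}{\psi^\circ}, & K'&=\frac{\psi_1^\circ\psi_2^\circ}{\psi_{12}^\circ\psi^\circ}K, & P'&=\frac{\psi_1^\circ\varphi_1^\circ}{\psi_{11}^\circ\varphi^\circ}P, & Q'&=\frac{\psi_2^\circ\varphi_2^\circ}{\psi_{22}^\circ\varphi^\circ}Q, \end{aligned}$$ i.e. the primed quantities satisfy the same equations.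
   Context: For a function $h$ on $\mathbb{Z}^2$, $h_1(n_1,n_2)=h(n_1+1,n_2)$, $h_2(n_1,n_2)=h(n_1,n_2+1)$, multiple subscripts denote repeated shifts, and $\Delta_ih=h_i-h$. The superscripts on the constants $c^0,\dots,c^3$ and the symbol ${}^\circ$ are labels. $\varphi,\psi$ take values in a real vector space (in the geometric application $\mathbb{R}^6$, as homogeneous coordinates of $\mathbb{P}^5$). It is understood that all expressions are well defined, i.e. all denominators occurring (also in the transformed equations) are non-zero, in particular $\lambda,\lambda_\circ\ne0$ and $\lambda^2\ne\lambda_\circ^2$. *)

(* Defs.v *)
From HB Require Import structures.
From mathcomp Require Import all_boot all_order all_algebra.
From mathcomp Require Import reals.

Set Implicit Arguments.
Unset Strict Implicit.
Unset Printing Implicit Defensive.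

Import Order.TTheory GRing.Theory Num.Theory.
Local Open Scope ring_scope.

Definition lattice : Type := (int * int)%type.

(* [s1 h] and [s2 h] are h_1 and h_2; h_12 is [s1 (s2 h)], h_11 is
   [s1 (s1 h)], and so on. *)
Definition s1 (T : Type) (h : lattice -> T) : lattice -> T :=
  fun n => h (n.1 + 1, n.2).
Definition s2 (T : Type) (h : lattice -> T) : lattice -> T :=
  fun n => h (n.1, n.2 + 1).

Definition D1 (V : zmodType) (h : lattice -> V) : lattice -> V :=
  fun n => s1 h n - h n.
Definition D2 (V : zmodType) (h : lattice -> V) : lattice -> V :=
  fun n => s2 h n - h n.

Section Demoulin.
Variable R : realType.
Implicit Types (H K A Q B P f g : lattice -> R) (n : lattice).

Definition denH H K A Q n : R :=
  K n * (H n * (s1 H n - 1) * (s2 H n - 1) - (H n - 1)) * (s2 K n - 1)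
  - A n * Q n * s1 H n * s2 K n * (s2 H n - 1).

Definition denK H K A Q n : R :=
  H n * (K n * (s1 K n - 1) * (s2 K n - 1) - (K n - 1)) * (s1 H n - 1)
  - A n * Q n * s1 H n * s2 K n * (s1 K n - 1).

(* Every denominator in the Demoulin system, in the relations for B and P and
   in the linear system is a product of (shifts of) these quantities and of the
   spectral parameter. *)
Record nonzero_denominators H K A Q : Prop := NonzeroDenominators {
  nd_H0 : forall n, H n != 0;
  nd_K0 : forall n, K n != 0;
  nd_H1 : forall n, H n - 1 != 0;
  nd_K1 : forall n, K n - 1 != 0;
  nd_denH : forall n, denH H K A Q n != 0;
  nd_denK : forall n, denK H K A Q n != 0
}.

Record demoulin_system H K A Q : Prop := DemoulinSystem {
  demoulin_H12 : forall n, s1 (s2 H) n =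
    - (K n * (H n - 1) * (s2 K n - 1) / denH H K A Q n);
  demoulin_K12 : forall n, s1 (s2 K) n =
    - (H n * (K n - 1) * (s1 H n - 1) / denK H K A Q n);
  demoulin_A2 : forall n, s2 A n = s1 H n / K n * A n;
  demoulin_Q1 : forall n, s1 Q n = s2 K n / H n * Q n
}.

Record BP_relations H K A Q B P : Prop := BPRelations {
  BP_B : forall n, B n =
    (s2 H n - 1) * (K n - 1) * s2 K n / ((H n - 1) * (s2 K n - 1) * s2 H n)
    * Q n;
  BP_P : forall n, P n =
    (H n - 1) * (s1 K n - 1) * s1 H n / ((s1 H n - 1) * (K n - 1) * s1 K n)
    * A n
}.

Record linear_system (V : lmodType R) (lam : R) H K A B P Q
    (phi psi : lattice -> V) : Prop := LinearSystem {
  linear_phi11 : forall n, s1 (s1 phi) n = s1 phi n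
    + ((1 - s1 H n) / ((1 - H n) * s1 H n)) *: (s1 phi n - phi n)
    + (lam * A n / (K n - 1)) *: (s1 (s2 psi) n - s1 psi n);
  linear_phi22 : forall n, s2 (s2 phi) n = s2 phi n
    + ((1 - s2 H n) / ((1 - H n) * s2 H n)) *: (s2 phi n - phi n)
    + (B n / (lam * (K n - 1))) *: (s1 (s2 psi) n - s2 psi n);
  linear_phi12 : forall n, s1 (s2 phi) n =
    - phi n + H n *: (s1 phi n + s2 phi n);
  linear_psi11 : forall n, s1 (s1 psi) n = s1 psi n
    + ((1 - s1 K n) / ((1 - K n) * s1 K n)) *: (s1 psi n - psi n)
    + (lam * P n / (H n - 1)) *: (s1 (s2 phi) n - s1 phi n);
  linear_psi22 : forall n, s2 (s2 psi) n = s2 psi n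
    + ((1 - s2 K n) / ((1 - K n) * s2 K n)) *: (s2 psi n - psi n)
    + (Q n / (lam * (H n - 1))) *: (s1 (s2 phi) n - s2 phi n);
  linear_psi12 : forall n, s1 (s2 psi) n =
    - psi n + K n *: (s1 psi n + s2 psi n)
}.

Definition admissible H K (phi0 psi0 : lattice -> R) : Prop :=
  forall n,
    phi0 n ^+ 2 - H n / (H n - 1) * D1 phi0 n * D2 phi0 n =
    psi0 n ^+ 2 - K n / (K n - 1) * D1 psi0 n * D2 psi0 n.

Definition c0 (lam lam0 : R) : R := lam0 ^+ 2 / (lam ^+ 2 - lam0 ^+ 2).
Definition c1 (lam lam0 : R) : R := lam0 * lam / (lam ^+ 2 - lam0 ^+ 2).
Definition c2 (lam lam0 : R) : R := lam ^+ 2 / (lam ^+ 2 - lam0 ^+ 2).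
Definition c3 (lam lam0 : R) : R :=
  (lam ^+ 2 + lam0 ^+ 2) / (lam ^+ 2 - lam0 ^+ 2).

Definition potS (V : lmodType R) (lam lam0 : R) H K (phi0 psi0 : lattice -> R)
    (phi psi : lattice -> V) : lattice -> V := fun n =>
  (c3 lam lam0 * phi0 n) *: phi n - (2 * c1 lam lam0 * psi0 n) *: psi n
  - (H n / (H n - 1)) *: ((c2 lam lam0 * D1 phi0 n) *: D2 phi n
                          + (c0 lam lam0 * D2 phi0 n) *: D1 phi n)
  + (K n / (K n - 1) * c1 lam lam0) *: (D1 psi0 n *: D2 psi n
                                        + D2 psi0 n *: D1 psi n).

Definition potR (V : lmodType R) (lam lam0 : R) H K (phi0 psi0 : lattice -> R)
    (phi psi : lattice -> V) : lattice -> V := fun n =>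
  (c3 lam lam0 * psi0 n) *: psi n - (2 * c1 lam lam0 * phi0 n) *: phi n
  - (K n / (K n - 1)) *: ((c2 lam lam0 * D1 psi0 n) *: D2 psi n
                          + (c0 lam lam0 * D2 psi0 n) *: D1 psi n)
  + (H n / (H n - 1) * c1 lam lam0) *: (D1 phi0 n *: D2 phi n
                                        + D2 phi0 n *: D1 phi n).

Definition new_phi (V : lmodType R) (lam lam0 : R) H K
    (phi0 psi0 : lattice -> R) (phi psi : lattice -> V) : lattice -> V :=
  fun n => (phi0 n)^-1 *: potS lam lam0 H K phi0 psi0 phi psi n.

Definition new_psi (V : lmodType R) (lam lam0 : R) H K
    (phi0 psi0 : lattice -> R) (phi psi : lattice -> V) : lattice -> V :=
  fun n => (psi0 n)^-1 *: potR lam lam0 H K phi0 psi0 phi psi n.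

(* H' is [new12 phi0 H] and K' is [new12 psi0 K]. *)
Definition new12 f H : lattice -> R := fun n =>
  s1 f n * s2 f n / (s1 (s2 f) n * f n) * H n.

(* A' is [new11 phi0 psi0 A] and P' is [new11 psi0 phi0 P]. *)
Definition new11 f g A : lattice -> R := fun n =>
  s1 f n * s1 g n / (s1 (s1 f) n * g n) * A n.

(* B' is [new22 phi0 psi0 B] and Q' is [new22 psi0 phi0 Q]. *)
Definition new22 f g B : lattice -> R := fun n =>
  s2 f n * s2 g n / (s2 (s2 f) n * g n) * B n.

End Demoulin.

(* Main.v *)
Require Import Defs.
From mathcomp Require Import all_boot all_order all_algebra.
From mathcomp Require Import reals.
From mathcomp Require Import ring.

Set Implicit Arguments.
Unset Strict Implicit.
Unset Printing Implicit Defensive.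

Import Order.TTheory GRing.Theory Num.Theory.
Local Open Scope ring_scope.

(** Write f, g for the seed solution phi0, psi0, with h = H / (H - 1) and
    k = K / (K - 1).

    The proof rests on one scalar, the energy
      E = f^2 - h (D1 f) (D2 f),
    which by admissibility is the same for (f, H) and for (g, K).  The equation
    f_12 = - f + H (f_1 + f_2) turns it into (f_12 f - H f_1 f_2) / (H - 1), so
    that
      H' - 1 = - (H - 1) E / (f_12 f),   K' - 1 = - (K - 1) E / (g_12 g)
    ([new12_sub1]).  This makes the relations for B and P monomial identities,
    as the evolution of A and Q is from the outset.  It also shows that E never
    vanishes when H' is different from 1.

    For the Demoulin system itself, the relations for B and P bring both of its
    face equations to a single shape, exchanged by (H, A, B) <-> (K, P, Q):
      1 / H_12 = 1 + A B H_1 H_2 / (K (K - 1)) - h (H_1 - 1) (H_2 - 1)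
    ([demoulin_face]).  The new face equation then amounts to an identity
    between E, E_1, E_2 and E_12 ([energy_quad]).  With X_i = f_12 - f_i and
    Y_i = g_12 - g_i the energy moves by
      E_1 = E - a X_1 Y_1,   E_2 = E - b X_2 Y_2,
    with a = lam0 A H_1 / ((H_1 - 1) (K - 1)) and
    b = B H_2 / (lam0 (H_2 - 1) (K - 1)).  In these variables the identity
    follows from E = f_12^2 - h X_1 X_2 = g_12^2 - k Y_1 Y_2.

    For the linear system, write S and R for the two potentials.  Each is a
    Moutard potential:
      S_1 - S = f phi_1 - f_1 phi,   S_2 - S = f_2 phi - f phi_2
    ([D1_potS], [D2_potS]), and this gives the equation for phi'_12 at once.
    The equation for phi'_11 mixes S and R.  It closes because the combination
    S + (lam / lam0) R has no c-constants left, which makes its shift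
    an explicit bilinear expression in the data of one face ([potS_potR]);
    the rest is a comparison of coefficients ([new_linear11]).

    Two symmetries give everything else.  Exchanging phi and psi exchanges
    S and R.  Transposing the lattice inverts both spectral parameters and
    changes the sign of S and R; the equations being linear in (phi', psi'),
    that sign is harmless. *)

(** * Comparing coefficients of linear combinations *)

(** Linear combinations are reified so that an identity between vectors
    follows from the identities between the coefficients of the vectors
    involved, and these are within reach of the decision procedure for
    fields. *)
Section VectorIdentities.
Variables (R : pzRingType) (V : lmodType R).

Inductive vexpr : Type :=
| VVar of nat
| VAdd of vexpr & vexpr
| VOpp of vexpr
| VScale of R & vexpr.

Fixpoint veval (env : seq V) (e : vexpr) : V :=
  match e with
  | VVar i => nth 0 env i
  | VAdd e1 e2 => veval env e1 + veval env e2
  | VOpp e1 => - veval env e1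
  | VScale a e1 => a *: veval env e1
  end.

Fixpoint vcoef (e : vexpr) (i : nat) : R :=
  match e with
  | VVar j => if eqn i j then 1 else 0
  | VAdd e1 e2 => vcoef e1 i + vcoef e2 i
  | VOpp e1 => - vcoef e1 i
  | VScale a e1 => a * vcoef e1 i
  end.

Lemma veval_sum env e :
  veval env e = \sum_(i < size env) vcoef e i *: nth 0 env i.
Proof.
elim: e => [j|e1 IH1 e2 IH2|e1 IH1|a e1 IH1] /=.
  case: (ltnP j (size env)) => [lt_j|le_j]; last first.
    rewrite nth_default // big1 // => i _.
    by rewrite eqnE (ltn_eqF (leq_trans (ltn_ord i) le_j)) scale0r.
  rewrite (bigD1 (Ordinal lt_j)) //= eqnE eqxx scale1r big1 ?addr0 // => i.
  by rewrite -val_eqE /= => /negPf ->; rewrite scale0r.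
- by rewrite IH1 IH2 -big_split; apply: eq_bigr => i _; rewrite scalerDl.
- by rewrite IH1 -sumrN; apply: eq_bigr => i _; rewrite scaleNr.
- by rewrite IH1 scaler_sumr; apply: eq_bigr => i _; rewrite scalerA.
Qed.

Lemma veval_eq env e1 e2 :
  foldr and True [seq vcoef e1 i = vcoef e2 i | i <- iota 0 (size env)] ->
  veval env e1 = veval env e2.
Proof.
move=> eq_coef; rewrite !veval_sum; apply: eq_bigr => i _; congr (_ *: _).
have: nat_of_ord i \in iota 0 (size env) by rewrite mem_iota /=.
elim: (iota 0 _) eq_coef => //= j s IH [eq_j /IH eq_s].
by rewrite inE => /orP[/eqP ->|/eq_s].
Qed.

End VectorIdentities.

(* Two shifts of a function may differ in the structure from which their type
   is inferred, hence unification rather than matching. *)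
Ltac vindex x env :=
  lazymatch env with
  | ?y :: ?s => match goal with
    | _ => let _ := match goal with _ => unify x y end in constr:(0%N)
    | _ => let k := vindex x s in constr:(k.+1)
    end
  end.

Ltac vreify R env e :=
  lazymatch e with
  | ?a + ?b => let x := vreify R env a in let y := vreify R env b in
               constr:(@VAdd R x y)
  | - ?a => let x := vreify R env a in constr:(@VOpp R x)
  | ?c *: ?a => let x := vreify R env a in constr:(@VScale R c x)
  | _ => let k := vindex e env in constr:(@VVar R k)
  end.

Ltac by_coefficients R env :=
  lazymatch goal with
  | |- ?l = ?r =>
    let x := vreify R env l in let y := vreify R env r in
    refine (@veval_eq R _ env x y _); rewrite /=; repeat split
  end.

(** * Symmetries of the system *)

(** Composition with the reflection exchanging the two lattice directions. *)
Definition tr (T : Type) (h : lattice -> T) : lattice -> T :=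
  fun n => h (n.2, n.1).

Section Symmetries.
Variable R : realType.
Implicit Types (H K A Q B P f g : lattice -> R) (n : lattice).

(** The part of the hypotheses that is shared by the old and the new
    coefficients; it is closed under the symmetries, in contrast to the four
    equations of the Demoulin system. *)
Record background H K A B P Q : Prop := Background {
  bg_H0 : forall n, H n != 0;
  bg_K0 : forall n, K n != 0;
  bg_H1 : forall n, H n - 1 != 0;
  bg_K1 : forall n, K n - 1 != 0;
  bg_BP : BP_relations H K A Q B P
}.

(** B is proportional to Q and P to A, so each relation can be solved the other
    way round. *)
Lemma background_swap H K A B P Q :
  background H K A B P Q -> background K H P Q A B.
Proof.
case=> H0 K0 H1 K1 [eB eP]; split=> //; split=> n.
- by rewrite eB; field; rewrite /s2 !(H0, K0, H1, K1).
- by rewrite eP; field; rewrite /s1 !(H0, K0, H1, K1).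
Qed.

Lemma background_tr H K A B P Q :
  background H K A B P Q ->
  background (tr H) (tr K) (tr B) (tr A) (tr Q) (tr P).
Proof.
move=> bg; have [_ _ _ _ [eQ eA]] := background_swap bg.
case: bg => H0 K0 H1 K1 _; split=> [n|n|n|n|]; rewrite /tr ?H0 ?K0 ?H1 ?K1 //.
by split=> -[i j]; rewrite /tr /s1 /s2 /=;
  [rewrite (eA (j, i))|rewrite (eQ (j, i))];
  by rewrite /s1 /s2 /=; congr (_ / _ * _); ring.
Qed.

Lemma linear_system_swap (V : lmodType R) lam H K A B P Q
    (phi psi : lattice -> V) :
  linear_system lam H K A B P Q phi psi ->
  linear_system lam K H P Q A B psi phi.
Proof. by case. Qed.

(** The parameter is inverted since it multiplies A and P in the first direction
    and divides B and Q in the second one. *)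
Lemma linear_system_tr (V : lmodType R) lam H K A B P Q
    (phi psi : lattice -> V) :
  linear_system lam H K A B P Q phi psi ->
  linear_system lam^-1 (tr H) (tr K) (tr B) (tr A) (tr Q) (tr P)
    (tr phi) (tr psi).
Proof.
case=> phi11 phi22 phi12 psi11 psi22 psi12.
have eA x y : x / (lam^-1 * y) = lam * x / y.
  by rewrite invfM invrK mulrCA mulrA.
have eB x y : lam^-1 * x / y = x / (lam * y).
  by rewrite invfM mulrA [x / lam]mulrC.
split=> -[i j].
- rewrite eB; exact: (phi22 (j, i)).
- rewrite eA; exact: (phi11 (j, i)).
- rewrite [s1 _ _ + _]addrC; exact: (phi12 (j, i)).
- rewrite eB; exact: (psi22 (j, i)).
- rewrite eA; exact: (psi11 (j, i)).
- rewrite [s1 _ _ + _]addrC; exact: (psi12 (j, i)).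
Qed.

(** Both sides of the admissible constraint. *)
Definition energy H f n : R := f n ^+ 2 - H n / (H n - 1) * D1 f n * D2 f n.

Lemma energy_tr H f i j : energy (tr H) (tr f) (j, i) = energy H f (i, j).
Proof. by rewrite /energy mulrAC. Qed.

End Symmetries.


(** * The seed solution and its energy *)

Section Energy.
Variable R : realType.
Implicit Types (n : lattice) (H K A B P Q f g : lattice -> R).

Record seed (lam0 : R) H K A B P Q f g : Prop := Seed {
  seed_bg : background H K A B P Q;
  seed_lam0 : lam0 != 0;
  seed_f0 : forall n, f n != 0;
  seed_g0 : forall n, g n != 0;
  seed_linear : @linear_system R R^o lam0 H K A B P Q f g;
  seed_admissible : forall n, energy H f n = energy K g n
}.

Lemma seed_swap lam0 H K A B P Q f g :
  seed lam0 H K A B P Q f g -> seed lam0 K H P Q A B g f.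
Proof.
case=> bg l0 f0 g0 lin adm.
by split=> //; [exact: background_swap bg | exact: linear_system_swap lin].
Qed.

Lemma seed_tr lam0 H K A B P Q f g :
  seed lam0 H K A B P Q f g ->
  seed lam0^-1 (tr H) (tr K) (tr B) (tr A) (tr Q) (tr P) (tr f) (tr g).
Proof.
case=> bg l0 f0 g0 lin adm; split.
- exact: background_tr.
- by rewrite invr_eq0.
- by move=> n; exact: f0.
- by move=> n; exact: g0.
- exact: (linear_system_tr lin).
- by case=> j i; rewrite !energy_tr.
Qed.

Section SeedFacts.
Variables (lam0 : R) (H K A B P Q f g : lattice -> R).
Hypothesis sd : seed lam0 H K A B P Q f g.

Let H0 := bg_H0 (seed_bg sd).
Let H1 := bg_H1 (seed_bg sd).
Let K1 := bg_K1 (seed_bg sd).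
Let lin0 := seed_linear sd.

Let H1' n : 1 - H n != 0.
Proof. by rewrite -opprB oppr_eq0. Qed.

Lemma seed12 n : s1 (s2 f) n = - f n + H n * (s1 f n + s2 f n).
Proof. exact: (linear_phi12 lin0 n). Qed.

Lemma seed11 n : s1 (s1 f) n = s1 f n
  + (1 - s1 H n) / ((1 - H n) * s1 H n) * (s1 f n - f n)
  + lam0 * A n / (K n - 1) * (s1 (s2 g) n - s1 g n).
Proof. exact: (linear_phi11 lin0 n). Qed.

(** The energy of a face is determined by H and the four corner values, and the
   next lemmas express it in the corner variables suited to each later use. *)
Lemma energy_face n :
  (H n - 1) * energy H f n = s1 (s2 f) n * f n - H n * (s1 f n * s2 f n).
Proof. by rewrite /energy /D1 /D2 seed12; field. Qed.

Lemma energy_opposite n : energy H f n = s1 (s2 f) n ^+ 2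
  - H n / (H n - 1) * (s1 (s2 f) n - s1 f n) * (s1 (s2 f) n - s2 f n).
Proof. by rewrite /energy /D1 /D2 seed12; field. Qed.

Lemma energy_edge n : energy H f n =
  s1 f n ^+ 2 - (s1 (s2 f) n - s1 f n) * (s1 f n - f n) / (H n - 1).
Proof. by rewrite /energy /D1 /D2 seed12; field. Qed.

(** [seed11] makes h_1 times the shifted difference D1 f equal to
    D1 f / (H - 1) up to a coupling term; the first part reproduces the energy,
    by [energy_edge].  The correction is symmetric in (f, H, A) and (g, K, P)
    because of the relation between P and A, so the admissible constraint
    propagates. *)
Lemma energy_s1 n : s1 (energy H f) n = energy H f n
  - lam0 * A n * s1 H n / ((s1 H n - 1) * (K n - 1))
    * (s1 (s2 f) n - s1 f n) * (s1 (s2 g) n - s1 g n).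
Proof.
rewrite energy_edge.
have -> : s1 (energy H f) n = s1 f n ^+ 2 - s1 H n / (s1 H n - 1)
  * (s1 (s1 f) n - s1 f n) * (s1 (s2 f) n - s1 f n) by [].
rewrite seed11; field.
by rewrite /s1 !(H0, H1, K1, H1').
Qed.

(** The differences leaving the far corner of a face enter the energy of the
    diagonally shifted face. *)
Lemma seed112 n : s1 (s1 (s2 f)) n - s1 (s2 f) n = (s1 H n - 1) *
  (H n / (H n - 1) * (s1 (s2 f) n - s2 f n)
   + lam0 * A n * s1 H n / ((s1 H n - 1) * (K n - 1))
     * (s1 (s2 g) n - s1 g n)).
Proof.
have -> : s1 (s1 (s2 f)) n = - s1 f n + s1 H n * (s1 (s1 f) n + s1 (s2 f) n).
  exact: (linear_phi12 lin0 (n.1 + 1, n.2)).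
rewrite seed11 seed12; field.
by rewrite /s1 !(H0, H1, K1, H1').
Qed.

End SeedFacts.

Lemma energy_s2 lam0 H K A B P Q f g n : seed lam0 H K A B P Q f g ->
  s2 (energy H f) n = energy H f n
  - lam0^-1 * B n * s2 H n / ((s2 H n - 1) * (K n - 1))
    * (s1 (s2 f) n - s2 f n) * (s1 (s2 g) n - s2 g n).
Proof.
case: n => i j sd; have := energy_s1 (seed_tr sd) (j, i).
by rewrite /s1 !energy_tr.
Qed.

Lemma seed122 lam0 H K A B P Q f g n : seed lam0 H K A B P Q f g ->
  s1 (s2 (s2 f)) n - s1 (s2 f) n = (s2 H n - 1) *
  (H n / (H n - 1) * (s1 (s2 f) n - s1 f n)
   + lam0^-1 * B n * s2 H n / ((s2 H n - 1) * (K n - 1))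
     * (s1 (s2 g) n - s2 g n)).
Proof. by case: n => i j sd; exact: (seed112 (seed_tr sd) (j, i)). Qed.

(** * Transformation of the coefficients *)

(** The reason for introducing the energy: the numerator of H' - 1 is, up to a
    factor, the expression in [energy_face]. *)
Lemma new12_sub1 lam0 H K A B P Q f g n : seed lam0 H K A B P Q f g ->
  new12 f H n - 1 = - ((H n - 1) * energy H f n / (s1 (s2 f) n * f n)).
Proof.
move=> sd; rewrite (energy_face sd) /new12; field.
by rewrite /s1 /s2 !(seed_f0 sd).
Qed.

(** The first equation of the Demoulin system in terms of H, K, A and B; the
    second one is the same statement for K, H, P and Q. *)
Definition demoulin_face H K A B n : Prop :=
  (s1 (s2 H) n)^-1 = 1 + A n * B n * s1 H n * s2 H n / (K n * (K n - 1))
    - H n * (s1 H n - 1) * (s2 H n - 1) / (H n - 1).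

Lemma demoulin_H12P H K A B P Q n : background H K A B P Q ->
  s1 (s2 H) n = - (K n * (H n - 1) * (s2 K n - 1) / denH H K A Q n)
  <-> demoulin_face H K A B n.
Proof.
move=> bg; have [H0 K0 H1 K1 [eB _]] := bg.
rewrite /demoulin_face.
set X := 1 + _ - _.
have -> : - (K n * (H n - 1) * (s2 K n - 1) / denH H K A Q n) = X^-1.
  have -> : denH H K A Q n = - (K n * (H n - 1) * (s2 K n - 1)) * X.
    by rewrite /denH /X eB; field; rewrite /s2 !(H0, K0, H1, K1).
  rewrite -mulNr invfM mulrA divff ?mul1r //.
  by rewrite oppr_eq0 !mulf_neq0 // K1.
by split=> [->|<-]; rewrite invrK.
Qed.

Lemma demoulin_K12P H K A B P Q n : background H K A B P Q ->
  s1 (s2 K) n = - (H n * (K n - 1) * (s1 H n - 1) / denK H K A Q n)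
  <-> demoulin_face K H P Q n.
Proof.
move=> bg; have [H0 K0 H1 K1 [_ eP]] := bg.
rewrite /demoulin_face.
set X := 1 + _ - _.
have -> : - (H n * (K n - 1) * (s1 H n - 1) / denK H K A Q n) = X^-1.
  have -> : denK H K A Q n = - (H n * (K n - 1) * (s1 H n - 1)) * X.
    by rewrite /denK /X eP; field; rewrite /s1 !(H0, K0, H1, K1).
  rewrite -mulNr invfM mulrA divff ?mul1r //.
  by rewrite oppr_eq0 !mulf_neq0 // H1.
by split=> [->|<-]; rewrite invrK.
Qed.

(** The factor 1 - 1 / H_12 clears the denominator of the diagonally shifted
    energy and is also what the face equation computes. *)
Lemma energy_s12 H f n : H (n.1+1,n.2+1) != 0 -> H (n.1+1,n.2+1) - 1 != 0 ->
  (1 - (s1 (s2 H) n)^-1) * s1 (s2 (energy H f)) n =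
  (1 - (s1 (s2 H) n)^-1) * s1 (s2 f) n ^+ 2
  - (s1 (s1 (s2 f)) n - s1 (s2 f) n) * (s1 (s2 (s2 f)) n - s1 (s2 f) n).
Proof.
move=> Hn0 Hn1.
have -> : s1 (s2 (energy H f)) n = s1 (s2 f) n ^+ 2
  - s1 (s2 H) n / (s1 (s2 H) n - 1)
  * (s1 (s1 (s2 f)) n - s1 (s2 f) n) * (s1 (s2 (s2 f)) n - s1 (s2 f) n) by [].
by field; rewrite Hn0 Hn1.
Qed.

(** The invariance of the face equation, stripped of the monomial factors:
    each of the three terms 1 - 1 / H_12, h (H_1 - 1) (H_2 - 1) and
    A B H_1 H_2 / (K (K - 1)) acquires its own weight. *)
Lemma energy_quad lam0 H K A B P Q f g n : seed lam0 H K A B P Q f g ->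
  demoulin_face H K A B n ->
  (1 - (s1 (s2 H) n)^-1) * (s1 (s2 (energy H f)) n * energy H f n) =
  H n * (s1 H n - 1) * (s2 H n - 1) / (H n - 1)
    * (s1 (energy H f) n * s2 (energy H f) n)
  - A n * B n * s1 H n * s2 H n / (K n * (K n - 1))
    * (s1 (s2 f) n * s1 (s2 g) n) ^+ 2.
Proof.
move=> sd face; have [H0 K0 H1 K1 _] := seed_bg sd.
rewrite [LHS]mulrA energy_s12 // (seed112 sd) (seed122 n sd) (energy_s1 sd).
rewrite (energy_s2 n sd) face exprMn.
(* Both squares at the far corner are traded for E plus a product of
   differences; after that the identity holds with E, X_i and Y_i free. *)
have /(canLR (subrK _)) <- := energy_opposite sd n.
have := energy_opposite (seed_swap sd) n.
rewrite -(seed_admissible sd) => /(canLR (subrK _)) <-.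
move: (energy H f n) (s1 (s2 f) n - s1 f n) (s1 (s2 f) n - s2 f n)
      (s1 (s2 g) n - s1 g n) (s1 (s2 g) n - s2 g n) => E X1 X2 Y1 Y2.
field.
by rewrite /s1 /s2 !(H0, K0, H1, K1, seed_lam0 sd).
Qed.

Lemma demoulin_face_new lam0 H K A B P Q f g n : seed lam0 H K A B P Q f g ->
  (forall m, energy H f m != 0) ->
  demoulin_face H K A B n ->
  demoulin_face (new12 f H) (new12 g K) (new11 f g A) (new22 f g B) n.
Proof.
move=> sd E0 face; have [H0 K0 H1 K1 _] := seed_bg sd.
have f0 := seed_f0 sd; have g0 := seed_g0 sd.
have quad : (1 - (s1 (s2 H) n)^-1) * s1 (s2 (energy H f)) n = _ :=
  canRL (mulfK (E0 n)) (etrans (esym (mulrA _ _ _)) (energy_quad sd face)).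
have e12 : (s1 (s2 (new12 f H)) n)^-1 = 1 + (1 - (s1 (s2 H) n)^-1)
  * s1 (s2 (energy H f)) n / (s1 (s1 (s2 f)) n * s1 (s2 (s2 f)) n).
  have := energy_face sd (n.1 + 1, n.2 + 1).
  set F := s1 (s1 (s2 (s2 f))) n.
  rewrite -[energy _ _ _]/(s1 (s2 (energy H f)) n).
  rewrite -[H _]/(s1 (s2 H) n) -[s1 (s2 f) _]/F -[f _]/(s1 (s2 f) n).
  rewrite -[s1 f _]/(s1 (s1 (s2 f)) n) -[s2 f _]/(s1 (s2 (s2 f)) n) => eF.
  have -> : s1 (s2 (energy H f)) n = (F * s1 (s2 f) n - s1 (s2 H) n *
     (s1 (s1 (s2 f)) n * s1 (s2 (s2 f)) n)) / (s1 (s2 H) n - 1).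
    by rewrite -eF mulrAC divff ?mul1r //; exact: H1.
  have -> : s1 (s2 (new12 f H)) n = s1 (s1 (s2 f)) n * s1 (s2 (s2 f)) n
     / (F * s1 (s2 f) n) * s1 (s2 H) n by [].
  by field; rewrite /F /s1 /s2 !(H0, H1, f0).
rewrite /demoulin_face e12 quad.
have -> : s1 (new12 f H) n - 1 = - ((s1 H n - 1) * s1 (energy H f) n /
  (s1 (s1 (s2 f)) n * s1 f n)) := new12_sub1 (n.1 + 1, n.2) sd.
have -> : s2 (new12 f H) n - 1 = - ((s2 H n - 1) * s2 (energy H f) n /
  (s1 (s2 (s2 f)) n * s2 f n)) := new12_sub1 (n.1, n.2 + 1) sd.
rewrite (new12_sub1 n sd) (new12_sub1 n (seed_swap sd)) -(seed_admissible sd).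
have -> : s1 (new12 f H) n = s1 (s1 f) n * s1 (s2 f) n
  / (s1 (s1 (s2 f)) n * s1 f n) * s1 H n by [].
have -> : s2 (new12 f H) n = s1 (s2 f) n * s2 (s2 f) n
  / (s1 (s2 (s2 f)) n * s2 f n) * s2 H n by [].
rewrite /new12 /new11 /new22; have := E0 n.
move: (energy H f n) (s1 (energy H f) n) (s2 (energy H f) n) => E E1 E2 En0.
by field; rewrite /s1 /s2 !(H0, K0, H1, K1, f0, g0, En0).
Qed.

Lemma BP_relations_new lam0 H K A B P Q f g : seed lam0 H K A B P Q f g ->
  (forall m, energy H f m != 0) ->
  BP_relations (new12 f H) (new12 g K) (new11 f g A) (new22 g f Q)
    (new22 f g B) (new11 g f P).
Proof.
move=> sd E0; have [H0 K0 H1 K1 [eB eP]] := seed_bg sd.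
have f0 := seed_f0 sd; have g0 := seed_g0 sd.
split=> n.
- have -> : s2 (new12 f H) n - 1 = - ((s2 H n - 1) * s2 (energy H f) n /
    (s1 (s2 (s2 f)) n * s2 f n)) := new12_sub1 (n.1, n.2 + 1) sd.
  have -> : s2 (new12 g K) n - 1 = - ((s2 K n - 1) * s2 (energy K g) n /
    (s1 (s2 (s2 g)) n * s2 g n)) := new12_sub1 (n.1, n.2 + 1) (seed_swap sd).
  rewrite (new12_sub1 n sd) (new12_sub1 n (seed_swap sd)).
  rewrite /new22 eB /s2 -!(seed_admissible sd) /new12 /s1 /s2 /=.
  have := E0 n; have := E0 (n.1, n.2 + 1).
  move: (energy _ _ _) (energy _ _ _) => E2 E E20 En0.
  by field; rewrite !(H0, K0, H1, K1, f0, g0, En0, E20).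
- have -> : s1 (new12 f H) n - 1 = - ((s1 H n - 1) * s1 (energy H f) n /
    (s1 (s1 (s2 f)) n * s1 f n)) := new12_sub1 (n.1 + 1, n.2) sd.
  have -> : s1 (new12 g K) n - 1 = - ((s1 K n - 1) * s1 (energy K g) n /
    (s1 (s1 (s2 g)) n * s1 g n)) := new12_sub1 (n.1 + 1, n.2) (seed_swap sd).
  rewrite (new12_sub1 n sd) (new12_sub1 n (seed_swap sd)).
  rewrite /new11 eP /s1 -!(seed_admissible sd) /new12 /s1 /s2 /=.
  have := E0 n; have := E0 (n.1 + 1, n.2).
  move: (energy _ _ _) (energy _ _ _) => E2 E E20 En0.
  by field; rewrite !(H0, K0, H1, K1, f0, g0, En0, E20).
Qed.

End Energy.


(** * Transformation of the linear system *)

Section Vector.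
Variables (R : realType) (V : lmodType R).
Implicit Types (lam : R) (n : lattice) (H K A B P Q f g : lattice -> R).
Implicit Types phi psi : lattice -> V.

(** A seed at lam0 together with a solution to be transformed at lam. *)
Record dressing lam lam0 H K A B P Q f g phi psi : Prop := Dressing {
  dr_lam : lam != 0;
  dr_lam2 : lam ^+ 2 != lam0 ^+ 2;
  dr_seed : seed lam0 H K A B P Q f g;
  dr_linear : linear_system lam H K A B P Q phi psi
}.

Lemma dressing_swap lam lam0 H K A B P Q f g phi psi :
  dressing lam lam0 H K A B P Q f g phi psi ->
  dressing lam lam0 K H P Q A B g f psi phi.
Proof.
by case=> ? ? /seed_swap ? /linear_system_swap ?.
Qed.

Lemma dressing_tr lam lam0 H K A B P Q f g phi psi :
  dressing lam lam0 H K A B P Q f g phi psi ->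
  dressing lam^-1 lam0^-1 (tr H) (tr K) (tr B) (tr A) (tr Q) (tr P)
    (tr f) (tr g) (tr phi) (tr psi).
Proof.
case=> l0 l2 /seed_tr sd /linear_system_tr lin; split=> //.
  by rewrite invr_eq0.
by rewrite !exprVn (inj_eq invr_inj).
Qed.

(** Shifting S produces second differences of phi and psi.  The coefficient
    h_1 turns that of phi into D1 phi / (H - 1) plus a coupling term; the
    coupling terms of the phi and psi parts have the same coefficient
    A H_1 / ((H_1 - 1) (K - 1)) by the relation for P, and cancel in view of
    lam0 c2 = lam c1 and lam0 c1 = lam c0. *)
Lemma D1_potS lam lam0 H K A B P Q f g phi psi n :
  dressing lam lam0 H K A B P Q f g phi psi ->
  s1 (potS lam lam0 H K f g phi psi) n =
  potS lam lam0 H K f g phi psi n + (f n *: s1 phi n - s1 f n *: phi n).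
Proof.
case=> lam_neq0 lam_neq sd lin.
have [H0 K0 H1 K1 [_ eP]] := seed_bg sd.
have -> : s1 (potS lam lam0 H K f g phi psi) n =
  (c3 lam lam0 * s1 f n) *: s1 phi n - (2 * c1 lam lam0 * s1 g n) *: s1 psi n
  - (s1 H n / (s1 H n - 1)) *:
      ((c2 lam lam0 * (s1 (s1 f) n - s1 f n)) *: (s1 (s2 phi) n - s1 phi n)
       + (c0 lam lam0 * (s1 (s2 f) n - s1 f n)) *: (s1 (s1 phi) n - s1 phi n))
  + (s1 K n / (s1 K n - 1) * c1 lam lam0) *:
      ((s1 (s1 g) n - s1 g n) *: (s1 (s2 psi) n - s1 psi n)
       + (s1 (s2 g) n - s1 g n) *: (s1 (s1 psi) n - s1 psi n)) by [].
rewrite (linear_phi11 lin) (linear_psi11 lin).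
rewrite (linear_phi12 lin) (linear_psi12 lin).
rewrite (seed11 sd) (seed11 (seed_swap sd)) (seed12 sd) (seed12 (seed_swap sd)).
rewrite /potS /D1 /D2 /c0 /c1 /c2 /c3 eP.
have l0 := seed_lam0 sd.
have d0 : lam ^+ 2 - lam0 ^+ 2 != 0 by rewrite subr_eq0.
have H1' m : 1 - H m != 0 by rewrite -opprB oppr_eq0.
have K1' m : 1 - K m != 0 by rewrite -opprB oppr_eq0.
by_coefficients R [:: phi n; s1 phi n; s2 phi n; psi n; s1 psi n; s2 psi n].
all: by field; rewrite /s1 !(H0, K0, H1, K1, H1', K1', d0, l0).
Qed.

(** Inverting both parameters maps (c0, c1, c2, c3) to (- c2, - c1, - c0, - c3).
    *)
Lemma potS_tr lam lam0 H K A B P Q f g phi psi i j :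
  dressing lam lam0 H K A B P Q f g phi psi ->
  potS lam^-1 lam0^-1 (tr H) (tr K) (tr f) (tr g) (tr phi) (tr psi) (j, i) =
  - potS lam lam0 H K f g phi psi (i, j).
Proof.
case=> l0 l2 sd _; have l00 := seed_lam0 sd; have [_ _ H1 K1 _] := seed_bg sd.
have d0 : lam ^+ 2 - lam0 ^+ 2 != 0 by rewrite subr_eq0.
have d0' : lam0 ^+ 2 + -1 * lam ^+ 2 != 0 by rewrite mulN1r -opprB oppr_eq0.
have D1_tr (h : lattice -> R) : D1 (tr h) (j, i) = D2 h (i, j) by [].
have D2_tr (h : lattice -> R) : D2 (tr h) (j, i) = D1 h (i, j) by [].
rewrite /potS !D1_tr !D2_tr /c0 /c1 /c2 /c3.
by_coefficients R [:: phi (i, j); D1 phi (i, j); D2 phi (i, j);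
                      psi (i, j); D1 psi (i, j); D2 psi (i, j)].
all: by rewrite /tr /=; field; rewrite !(H1, K1, d0, d0', l0, l00).
Qed.

Lemma D2_potS lam lam0 H K A B P Q f g phi psi n :
  dressing lam lam0 H K A B P Q f g phi psi ->
  s2 (potS lam lam0 H K f g phi psi) n =
  potS lam lam0 H K f g phi psi n + (s2 f n *: phi n - f n *: s2 phi n).
Proof.
case: n => i j dr; have := D1_potS (j, i) (dressing_tr dr).
rewrite /s1 !(potS_tr _ _ dr) => /(canRL opprK); rewrite opprD opprK opprB.
exact.
Qed.

(** In S + (lam / lam0) R the coefficients of f phi and g psi become - 1 and
    lam / lam0, and each of the h and k terms keeps only one of its two
    products, without any dependence on the c-constants. *)
Lemma potS_potR lam lam0 H K A B P Q f g phi psi n :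
  dressing lam lam0 H K A B P Q f g phi psi ->
  s1 (potS lam lam0 H K f g phi psi) n
  + (lam / lam0) *: s1 (potR lam lam0 H K f g phi psi) n =
  (lam / lam0) *: (s1 g n *: s1 psi n
     - ((s1 g n - g n) / (K n - 1)) *: (s1 (s2 psi) n - s1 psi n))
  - (s1 f n *: s1 phi n
     - ((s1 (s2 f) n - s1 f n) / (H n - 1)) *: (s1 phi n - phi n)).
Proof.
move=> dr; rewrite (D1_potS n dr).
have -> : s1 (potR lam lam0 H K f g phi psi) n =
  potR lam lam0 H K f g phi psi n + _ := D1_potS n (dressing_swap dr).
case: dr => _ l2 sd lin; have l00 := seed_lam0 sd.
have [_ _ H1 K1 _] := seed_bg sd.
have d0 : lam ^+ 2 - lam0 ^+ 2 != 0 by rewrite subr_eq0.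
rewrite (linear_psi12 lin) (seed12 sd).
rewrite /potS /potR /D1 /D2 /c0 /c1 /c2 /c3.
by_coefficients R [:: phi n; s1 phi n; s2 phi n; psi n; s1 psi n; s2 psi n].
all: by field; rewrite !(H1, K1, d0, l00).
Qed.

(** The first shift of R is eliminated by [potS_potR], leaving a
    relation between S_1, phi, phi_1, psi_1 and psi_12 whose five coefficients
    vanish separately. *)
Lemma new_linear11 lam lam0 H K A B P Q f g phi psi n :
  dressing lam lam0 H K A B P Q f g phi psi ->
  (forall m, energy H f m != 0) ->
  let phi' := new_phi lam lam0 H K f g phi psi in
  let psi' := new_psi lam lam0 H K f g phi psi in
  let H' := new12 f H in let K' := new12 g K in let A' := new11 f g A in
  s1 (s1 phi') n = s1 phi' n
    + ((1 - s1 H' n) / ((1 - H' n) * s1 H' n)) *: (s1 phi' n - phi' n)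
    + (lam * A' n / (K' n - 1)) *: (s1 (s2 psi') n - s1 psi' n).
Proof.
move=> dr E0 phi' psi' H' K' A'.
have [l0 _ sd lin] := dr.
have [H0 K0 H1 K1 _] := seed_bg sd.
have f0 := seed_f0 sd; have g0 := seed_g0 sd; have l00 := seed_lam0 sd.
have H1' m : 1 - H m != 0 by rewrite -opprB oppr_eq0.
have f11n : s1 (s1 f) n != 0 by exact: f0.
(* Multiplying by f_11 E removes both from the denominators, so that they can
   be replaced by their explicit expressions below. *)
have e_alpha : s1 (s1 f) n * energy H f n
    * ((1 - s1 H' n) / ((1 - H' n) * s1 H' n)) =
  (1 - s1 H n) / ((1 - H n) * s1 H n) * f n * s1 (energy H f) n.
  rewrite -opprB -[1 - H' n]opprB (new12_sub1 n sd).
  have -> : s1 H' n - 1 = - ((s1 H n - 1) * s1 (energy H f) n /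
    (s1 (s1 (s2 f)) n * s1 f n)) := new12_sub1 (n.1 + 1, n.2) sd.
  have -> : s1 H' n = s1 (s1 f) n * s1 (s2 f) n
    / (s1 (s1 (s2 f)) n * s1 f n) * s1 H n by [].
  have := E0 n; have : s1 (energy H f) n != 0 by exact: E0.
  move: (energy H f n) (s1 (energy H f) n) => E E1 En0 E10.
  by field; rewrite /s1 /s2 !(H0, H1, H1', f0, En0, E10).
have e_beta : s1 (s1 f) n * energy H f n * (lam * A' n / (K' n - 1)) =
    - (lam * A n / (K n - 1) * s1 f n * s1 g n * s1 (s2 g) n).
  rewrite (new12_sub1 n (seed_swap sd)) -(seed_admissible sd) /A' /new11.
  have := E0 n; move: (energy H f n) => E En0.
  by field; rewrite /s1 /s2 !(K1, f0, g0, En0).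
pose S := potS lam lam0 H K f g phi psi.
pose T := potR lam lam0 H K f g phi psi.
have eS11 : s1 (s1 S) n =
    s1 S n + (s1 f n *: s1 (s1 phi) n - s1 (s1 f) n *: s1 phi n) :=
  D1_potS (n.1 + 1, n.2) dr.
have eS : S n = s1 S n - (f n *: s1 phi n - s1 f n *: phi n) :=
  canRL (addrK _) (esym (D1_potS n dr)).
have eT12 : s1 (s2 T) n =
    s1 T n + (s1 (s2 g) n *: s1 psi n - s1 g n *: s1 (s2 psi) n) :=
  D2_potS (n.1 + 1, n.2) (dressing_swap dr).
have mu0 : lam / lam0 != 0 by rewrite mulf_neq0 // invr_eq0.
have eT1 : s1 T n = _ :=
  canRL (scalerK mu0) (canRL (addKr _) (potS_potR n dr)).
have -> : s1 (s1 phi') n = (s1 (s1 f) n)^-1 *: s1 (s1 S) n by [].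
have -> : s1 phi' n = (s1 f n)^-1 *: s1 S n by [].
have -> : phi' n = (f n)^-1 *: S n by [].
have -> : s1 (s2 psi') n = (s1 (s2 g) n)^-1 *: s1 (s2 T) n by [].
have -> : s1 psi' n = (s1 g n)^-1 *: s1 T n by [].
rewrite eS11 eS eT12 eT1 (linear_phi11 lin).
apply: (scalerI (mulf_neq0 f11n (E0 n))).
rewrite [RHS]scalerDr [in RHS]scalerDr (scalerA _ ((1 - s1 H' n) / _)) e_alpha.
rewrite (scalerA _ (lam * A' n / _)) e_beta.
rewrite [LHS]scalerA mulrAC divff // mul1r.
by_coefficients R [:: s1 S n; phi n; s1 phi n; s1 psi n; s1 (s2 psi) n].
(* The coefficients of S_1, phi and phi_1 need the energy expressed through f,
   those of psi_1 and psi_12 the energy expressed through g: this is where the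
   admissible constraint enters. *)
1-3: rewrite (energy_s1 sd) (energy_edge sd) (seed11 sd).
4-5: rewrite (seed_admissible sd) (energy_edge (seed_swap sd)).
all: by field; rewrite /s1 /s2 !(H0, H1, H1', K1, f0, g0, l0, l00).
Qed.

Lemma new_linear12 lam lam0 H K A B P Q f g phi psi n :
  dressing lam lam0 H K A B P Q f g phi psi ->
  let phi' := new_phi lam lam0 H K f g phi psi in
  s1 (s2 phi') n = - phi' n + new12 f H n *: (s1 phi' n + s2 phi' n).
Proof.
move=> dr phi'; have [_ _ sd lin] := dr; have f0 := seed_f0 sd.
pose S := potS lam lam0 H K f g phi psi.
have eS12 : s1 (s2 S) n =
    s2 S n + (s2 f n *: s1 (s2 phi) n - s1 (s2 f) n *: s2 phi n) :=
  D1_potS (n.1, n.2 + 1) dr.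
have eS1 : s1 S n = _ := D1_potS n dr.
have eS2 : s2 S n = _ := D2_potS n dr.
have -> : s1 (s2 phi') n = (s1 (s2 f) n)^-1 *: s1 (s2 S) n by [].
have -> : s1 phi' n = (s1 f n)^-1 *: s1 S n by [].
have -> : s2 phi' n = (s2 f n)^-1 *: s2 S n by [].
have f12 : s1 (s2 f) n != 0 by exact: f0.
rewrite eS12 eS1 eS2 (linear_phi12 lin) /phi' /new_phi.
apply: (scalerI f12).
have -> : new12 f H n = (s1 f n * s2 f n * H n / f n) / s1 (s2 f) n.
  by rewrite /new12; field; rewrite f12 f0.
rewrite [LHS]scalerA divff // scale1r [RHS]scalerDr.
rewrite (scalerA _ (_ / s1 (s2 f) n)) [_ * (_ / s1 (s2 f) n)]mulrC divfK //.
rewrite (seed12 sd).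
by_coefficients R
  [:: potS lam lam0 H K f g phi psi n; phi n; s1 phi n; s2 phi n].
all: by field; rewrite /s1 /s2 !f0.
Qed.

Lemma new_phi_tr lam lam0 H K A B P Q f g phi psi i j :
  dressing lam lam0 H K A B P Q f g phi psi ->
  new_phi lam^-1 lam0^-1 (tr H) (tr K) (tr f) (tr g) (tr phi) (tr psi) (j, i) =
  - new_phi lam lam0 H K f g phi psi (i, j).
Proof. by move=> dr; rewrite /new_phi (potS_tr _ _ dr) scalerN. Qed.

Lemma new12_tr H f i j : new12 (tr f) (tr H) (j, i) = new12 f H (i, j).
Proof. by rewrite /new12 -[s1 (tr f) _ * _]mulrC. Qed.

Lemma new_linear22 lam lam0 H K A B P Q f g phi psi n :
  dressing lam lam0 H K A B P Q f g phi psi ->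
  (forall m, energy H f m != 0) ->
  let phi' := new_phi lam lam0 H K f g phi psi in
  let psi' := new_psi lam lam0 H K f g phi psi in
  let H' := new12 f H in let K' := new12 g K in let B' := new22 f g B in
  s2 (s2 phi') n = s2 phi' n
    + ((1 - s2 H' n) / ((1 - H' n) * s2 H' n)) *: (s2 phi' n - phi' n)
    + (B' n / (lam * (K' n - 1))) *: (s1 (s2 psi') n - s2 psi' n).
Proof.
case: n => i j dr E0 phi' psi' H' K' B'.
have E0' m : energy (tr H) (tr f) m != 0 by case: m => ? ?; rewrite energy_tr.
have := new_linear11 (j, i) (dressing_tr dr) E0'.
rewrite /s1 !new12_tr !(new_phi_tr _ _ dr).
rewrite -[new_psi lam^-1 _ _ _ _ _ _ _]/(new_phi lam^-1 lam0^-1 (tr K) (tr H)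
  (tr g) (tr f) (tr psi) (tr phi)) /s2 !(new_phi_tr _ _ (dressing_swap dr)).
(* The transposed equation is the negative of the one sought. *)
rewrite -!opprD !scalerN -!opprD => /oppr_inj.
by rewrite [lam^-1 * _]mulrC -mulrA -invfM.
Qed.

End Vector.

Theorem theorem7p1 (R : realType) (V : lmodType R)
  (H K A Q B P : lattice -> R) (lam lam0 : R)
  (phi psi : lattice -> V) (phi0 psi0 : lattice -> R)
  (lam_neq0 : lam != 0) (lam0_neq0 : lam0 != 0)
  (lam_neq : lam ^+ 2 != lam0 ^+ 2)
  (nd : nonzero_denominators H K A Q)
  (phi0_neq0 : forall n, phi0 n != 0)
  (psi0_neq0 : forall n, psi0 n != 0)
  (hdem : demoulin_system H K A Q)
  (hBP : BP_relations H K A Q B P)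
  (hlin : linear_system lam H K A B P Q phi psi)
  (hlin0 : @linear_system R R^o lam0 H K A B P Q phi0 psi0)
  (hadm : admissible H K phi0 psi0) :
  let phi' := new_phi lam lam0 H K phi0 psi0 phi psi in
  let psi' := new_psi lam lam0 H K phi0 psi0 phi psi in
  let H' := new12 phi0 H in
  let K' := new12 psi0 K in
  let A' := new11 phi0 psi0 A in
  let P' := new11 psi0 phi0 P in
  let B' := new22 phi0 psi0 B in
  let Q' := new22 psi0 phi0 Q in
  nonzero_denominators H' K' A' Q' ->
  [/\ demoulin_system H' K' A' Q',
      BP_relations H' K' A' Q' B' P' &
      linear_system lam H' K' A' B' P' Q' phi' psi'].
Proof.
move=> phi' psi' H' K' A' P' B' Q' nd'.
have [H0 K0 H1 K1 _ _] := nd.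
have bg : background H K A B P Q by split.
have sd : seed lam0 H K A B P Q phi0 psi0 by split.
have dr : dressing lam lam0 H K A B P Q phi0 psi0 phi psi by split.
(* A vanishing energy would make H' equal to 1. *)
have E0 n : energy H phi0 n != 0.
  have := nd_H1 nd' n; rewrite (new12_sub1 n sd); apply: contraNneq => ->.
  by rewrite mulr0 mul0r oppr0.
have E0' n : energy K psi0 n != 0 by rewrite -(seed_admissible sd).
have bp' := BP_relations_new sd E0.
have bg' : background H' K' A' B' P' Q' by case: nd' => *; split.
split=> //.
- split=> n.
  + apply/(demoulin_H12P n bg')/(demoulin_face_new sd E0).
    exact/(demoulin_H12P n bg)/(demoulin_H12 hdem).
  + apply/(demoulin_K12P n bg')/(demoulin_face_new (seed_swap sd) E0').
    exact/(demoulin_K12P n bg)/(demoulin_K12 hdem).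
  + rewrite /A' /H' /K' /new11 /new12.
    have -> : s2 (new11 phi0 psi0 A) n = s1 (s2 phi0) n * s1 (s2 psi0) n
      / (s1 (s1 (s2 phi0)) n * s2 psi0 n) * s2 A n by [].
    have -> : s1 (new12 phi0 H) n = s1 (s1 phi0) n * s1 (s2 phi0) n
      / (s1 (s1 (s2 phi0)) n * s1 phi0 n) * s1 H n by [].
    rewrite (demoulin_A2 hdem); field.
    by rewrite /s1 /s2 !(K0, phi0_neq0, psi0_neq0).
  + rewrite /Q' /H' /K' /new22 /new12.
    have -> : s1 (new22 psi0 phi0 Q) n = s1 (s2 psi0) n * s1 (s2 phi0) n
      / (s1 (s2 (s2 psi0)) n * s1 phi0 n) * s1 Q n by [].
    have -> : s2 (new12 psi0 K) n = s1 (s2 psi0) n * s2 (s2 psi0) n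
      / (s1 (s2 (s2 psi0)) n * s2 psi0 n) * s2 K n by [].
    rewrite (demoulin_Q1 hdem); field.
    by rewrite /s1 /s2 !(H0, phi0_neq0, psi0_neq0).
- split=> n.
  + exact: (new_linear11 n dr E0).
  + exact: (new_linear22 n dr E0).
  + exact: (new_linear12 n dr).
  + exact: (new_linear11 n (dressing_swap dr) E0').
  + exact: (new_linear22 n (dressing_swap dr) E0').
  + exact: (new_linear12 n (dressing_swap dr)).
Qed.
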